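(* Let $m\ge 2$. (1) Let $\Omega\subset\mathbb{R}^m$ be an open set and let $\varphi:\Omega\to\mathbb{R}$ be an everywhere differentiable function satisfying the eikonal equation $|\nabla\varphi|=1$ at every point of $\Omega$. Then $\varphi\in\mathcal{C}^{1,1}(\Omega)$, i.e. $\nabla\varphi$ is locally Lipschitz in $\Omega$. (2) As a consequence, let $D\subsetneq\mathbb{R}^m$ be a domain and let $d_D$ be the signed distance function to $\partial D$. If $d_D$ is differentiable in an open neighborhood $U$ of $\partial D$, and $|\nabla d_D(x)|=1$ for every $x\in U\cap\partial D$, then $d_D\in\mathcal{C}^{1,1}(U)$.
   Context: $|\cdot|$ is the Euclidean norm on $\mathbb{R}^m$. A domain is a nonempty connected open set. For $D\subsetneq\mathbb{R}^m$, set $\delta_D(x):=\min_{y\in\partial D}|x-y|$; the signed distance function $d_D:\mathbb{R}^m\to\mathbb{R}$ is defined by $d_D:=\delta_D$ on $D$ and $d_D:=-\delta_D$ on $\mathbb{R}^m\setminus D$. For an open set $W$, $\mathcal{C}^{1,1}(W)$ denotes the functions that are differentiable on $W$ with locally Lipschitz gradient. Differentiability means (total, Fréchet) differentiability; no continuity of the gradient is assumed in the hypotheses. *)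

(* Defs.v *)
From HB Require Import structures.
From mathcomp Require Import all_boot all_order all_algebra.
From mathcomp Require Import boolp classical_sets reals topology normedtype derive.

Set Implicit Arguments.
Unset Strict Implicit.
Unset Printing Implicit Defensive.

Import Order.TTheory GRing.Theory Num.Theory.
Import numFieldNormedType.Exports.

Local Open Scope classical_set_scope.
Local Open Scope ring_scope.

(* The library norm on 'rV[R]_m is the sup norm.  It defines the same topology
   and the same differentiable functions as the Euclidean norm, so [open],
   [closure], [connected] and [differentiable] are the library's; lengths and
   distances use [enorm]. *)
Definition enorm (R : realType) (m : nat) (x : 'rV[R]_m) : R :=
  Num.sqrt (\sum_(i < m) x ord0 i ^+ 2).

(* Meaningful at points where f is differentiable: the differential of f at x
   is then v |-> \sum_i grad f x 0 i * v 0 i. *)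
Definition grad (R : realType) (m : nat) (f : 'rV[R]_m -> R) (x : 'rV[R]_m) :
    'rV[R]_m :=
  \row_(i < m) 'D_(delta_mx ord0 i) f x.

Definition locally_lipschitz (R : realType) (m n : nat) (W : set 'rV[R]_m)
    (F : 'rV[R]_m -> 'rV[R]_n) : Prop :=
  forall x, W x -> exists2 V : set 'rV[R]_m, nbhs x V &
    exists k : R, forall y z, (V `&` W) y -> (V `&` W) z ->
      enorm (F y - F z) <= k * enorm (y - z).

(* Functions on an open set W are represented by total functions; what happens
   outside W is irrelevant. *)
Definition C11 (R : realType) (m : nat) (W : set 'rV[R]_m)
    (f : 'rV[R]_m -> R) : Prop :=
  (forall x, W x -> differentiable f x) /\ locally_lipschitz W (grad f).

Definition domain (R : realType) (m : nat) (D : set 'rV[R]_m) : Prop :=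
  [/\ D !=set0, connected D & open D].

Definition boundary (T : topologicalType) (D : set T) : set T :=
  closure D `\` D°.

(* When D is neither empty nor the whole space, the boundary is closed and
   nonempty, so this infimum is a minimum. *)
Definition boundary_dist (R : realType) (m : nat) (D : set 'rV[R]_m)
    (x : 'rV[R]_m) : R :=
  inf [set enorm (x - y) | y in boundary D].

Definition signed_dist (R : realType) (m : nat) (D : set 'rV[R]_m)
    (x : 'rV[R]_m) : R :=
  if x \in D then boundary_dist D x else - boundary_dist D x.

(* Main.v *)
Require Import Defs.
From HB Require Import structures.
From mathcomp Require Import all_boot all_order all_algebra.
From mathcomp Require Import boolp classical_sets reals topology normedtype derive.
From mathcomp Require Import functions realfun ring lra.

(** For an everywhere differentiable solution of the eikonal equation no
    differential equation has to be solved to find the characteristics.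
    Write [p x] for the gradient of [f] at [x].  By the mean value theorem, [f]
    is 1-Lipschitz for the Euclidean distance on balls where the equation holds.
    Conversely [f] reaches the value [f x + r] on the closed ball of radius [r]
    around [x]: a maximum point of [f y - c * |y - x|] with [c < 1] cannot be
    interior, because at an interior point moving along the gradient increases
    [f] at rate 1 and the penalty at rate at most [c] ([eikonal_slope]); letting
    [c] tend to 1 gives the claim.  Together with the Lipschitz bound, this
    forces [f] to grow at rate exactly 1 on a radius of the ball, whose
    direction can then only be [p x].  So
    [f (x + r *: p x) >= f x + r] ([eikonal_ray]), and, for [- f],
    [f (x - r *: p x) <= f x - r].

    The Lipschitz bound between the far ends [x - r *: p x] and
    [y + r *: p y], and between [y - r *: p y] and [x + r *: p x], then gives
    with [a = f x - f y]
    [[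
      2 * r + a <= | (x - y) + r *: (p x + p y) |
      2 * r - a <= |- (x - y) + r *: (p x + p y) |.
    ]]
    Squaring, adding, and using [|p x + p y|^2 = 4 - |p x - p y|^2] leaves
    [r^2 * |p x - p y|^2 <= |x - y|^2 - a^2], a Lipschitz bound on the gradient
    with constant [r^-1] ([eikonal_grad_lipschitz]).

    The second part reduces to the first: away from the boundary the distance
    to the boundary is 1-Lipschitz and decreases at rate 1 towards a nearest
    boundary point, so its gradient has length 1 wherever it exists
    ([enorm_grad_boundary_dist]).  Nearest points exist because the boundary of
    a nonempty proper subset is closed and nonempty. *)

Set Implicit Arguments.
Unset Strict Implicit.
Unset Printing Implicit Defensive.

Import Order.TTheory GRing.Theory Num.Theory.
Import numFieldNormedType.Exports.

Local Open Scope classical_set_scope.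
Local Open Scope ring_scope.

(** * Euclidean geometry of row vectors *)

Section Euclidean.
Context {R : realType} {m : nat}.
Implicit Types (u v w x y : 'rV[R]_m) (a b c : R).

Definition edot u v : R := \sum_(i < m) u ord0 i * v ord0 i.

Lemma edotC u v : edot u v = edot v u.
Proof. by apply: eq_bigr => i _; rewrite mulrC. Qed.

Lemma edotDl u v w : edot (u + v) w = edot u w + edot v w.
Proof. by rewrite -big_split; apply: eq_bigr => i _; rewrite mxE mulrDl. Qed.

Lemma edotZl a u w : edot (a *: u) w = a * edot u w.
Proof. by rewrite mulr_sumr; apply: eq_bigr => i _; rewrite mxE mulrA. Qed.

Lemma edotNl u w : edot (- u) w = - edot u w.
Proof. by rewrite -scaleN1r edotZl mulN1r. Qed.

Lemma enorm_ge0 u : 0 <= enorm u.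
Proof. exact: sqrtr_ge0. Qed.

Lemma enorm_sqr u : enorm u ^+ 2 = edot u u.
Proof.
rewrite sqr_sqrtr; last by apply: sumr_ge0 => i _; exact: sqr_ge0.
by apply: eq_bigr => i _; rewrite expr2.
Qed.

Lemma enorm_sqrD u v :
  enorm (u + v) ^+ 2 = enorm u ^+ 2 + 2 * edot u v + enorm v ^+ 2.
Proof.
rewrite !enorm_sqr edotDl ![edot _ (u + v)]edotC !edotDl (edotC v u).
by ring.
Qed.

Lemma enormZ a u : enorm (a *: u) = `|a| * enorm u.
Proof.
apply/eqP; rewrite -(@eqrXn2 _ 2) ?mulr_ge0 ?enorm_ge0 //.
rewrite exprMn !enorm_sqr edotZl edotC edotZl real_normK ?num_real //.
by rewrite expr2 mulrA.
Qed.

Lemma enormN u : enorm (- u) = enorm u.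
Proof. by rewrite -scaleN1r enormZ normrN1 mul1r. Qed.

Lemma enormC u v : enorm (u - v) = enorm (v - u).
Proof. by rewrite -enormN opprB. Qed.

Lemma enorm0 : enorm (0 : 'rV[R]_m) = 0.
Proof. by rewrite -(scale0r 0) enormZ normr0 mul0r. Qed.

Lemma mx_norm_le_enorm u : `|u| <= enorm u.
Proof.
rewrite [leLHS]/Num.norm /= mx_normrE; apply/bigmax_leP; split=> [|[i j] _ /=].
  exact: enorm_ge0.
rewrite (ord1 i) -sqrtr_sqr ler_wsqrtr // (bigD1 j) //=.
by rewrite lerDl; apply: sumr_ge0 => k _; exact: sqr_ge0.
Qed.

Lemma enorm_eq0 u : enorm u = 0 -> u = 0.
Proof.
move=> u0; apply/eqP; rewrite -normr_eq0 eq_le normr_ge0 andbT.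
by rewrite -u0 mx_norm_le_enorm.
Qed.

(** The inequality is the nonnegativity of the squared length of
    [enorm v *: u - enorm u *: v], divided by [2 * enorm u * enorm v]. *)
Lemma edot_le u v : edot u v <= enorm u * enorm v.
Proof.
have [u0|un0] := eqVneq (enorm u) 0.
  by rewrite u0 mul0r (enorm_eq0 u0) -(scale0r 0) edotZl mul0r.
have [v0|vn0] := eqVneq (enorm v) 0.
  by rewrite v0 mulr0 (enorm_eq0 v0) edotC -(scale0r 0) edotZl mul0r.
have up : 0 < enorm u by rewrite lt_def un0 enorm_ge0.
have vp : 0 < enorm v by rewrite lt_def vn0 enorm_ge0.
have := sqr_ge0 (enorm (enorm v *: u - enorm u *: v)).
rewrite enorm_sqrD enormN !enormZ !ger0_norm ?enorm_ge0 //.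
rewrite edotZl edotC edotNl edotZl (edotC v u) => H.
have : 0 <= (enorm u * enorm v) * (enorm u * enorm v - edot u v) by nra.
by rewrite pmulr_rge0 ?mulr_gt0 // subr_ge0.
Qed.

Lemma enormD u v : enorm (u + v) <= enorm u + enorm v.
Proof.
have un := enorm_ge0 u; have vn := enorm_ge0 v.
rewrite -(ler_pXn2r (n := 2)) ?nnegrE ?addr_ge0 ?enorm_ge0 //.
by rewrite enorm_sqrD; have := edot_le u v; nra.
Qed.

Lemma enorm_distD w u v : enorm (u - v) <= enorm (u - w) + enorm (w - v).
Proof. by rewrite -(subrKA w u) enormD. Qed.

(** For unit vectors, the squared length of [u - v] is [2 - 2 * edot u v]. *)
Lemma unit_edot_eq u v : enorm u = 1 -> enorm v = 1 -> 1 <= edot u v -> u = v.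
Proof.
move=> u1 v1 uv; apply/eqP; rewrite -subr_eq0; apply/eqP/enorm_eq0.
have := sqr_ge0 (enorm (u - v)).
rewrite enorm_sqrD enormN u1 v1 edotC edotNl edotC => H.
apply/eqP; rewrite -sqrf_eq0 enorm_sqrD enormN u1 v1 edotC edotNl edotC.
by apply/eqP; lra.
Qed.

Lemma enorm_continuous : continuous (@enorm R m).
Proof.
move=> u; apply: (@continuous_comp _ _ _ _ (@Num.sqrt R)).
  apply: continuous_big => [|i _]; first exact: add_continuous.
  move=> v.
  apply: (@continuous_comp _ _ _ (fun v => v ord0 i) (fun t => t ^+ 2)).
    exact: coord_continuous.
  exact: exprn_continuous.
exact: sqrt_continuous.
Qed.

Lemma enorm_dist_continuous x : continuous (fun y => enorm (y - x)).
Proof.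
move=> y; apply: (@continuous_comp _ _ _ (fun y => y - x)).
  by apply: (@cvgB _ _ _ (nbhs y) _ id (cst x) y x) => [A|] //; exact: cvg_cst.
exact: enorm_continuous.
Qed.

Lemma compact_ecball x c : compact [set y | enorm (y - x) <= c].
Proof.
apply: bounded_closed_compact.
  exists (`|x| + c); split=> [|M xM y /= yxc]; first exact: num_real.
  rewrite -(subrK x y) (le_trans (ler_normD _ _)) // (le_trans _ (ltW xM)) //.
  by rewrite addrC lerD2l (le_trans (mx_norm_le_enorm _)).
have := @enorm_dist_continuous x.
by move/continuous_closedP/(_ [set t | t <= c]); apply; exact: closed_le.
Qed.

Lemma ecball_convex z c x y t : 0 <= t <= 1 ->
  enorm (x - z) <= c -> enorm (y - z) <= c ->
  enorm (x + t *: (y - x) - z) <= c.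
Proof.
move=> /andP[t0 t1] xc yc.
have -> : x + t *: (y - x) - z = (1 - t) *: (x - z) + t *: (y - z).
  by apply/rowP => i; rewrite !mxE; ring.
apply: (le_trans (enormD _ _)); rewrite !enormZ !ger0_norm ?subr_ge0 //.
by nra.
Qed.

End Euclidean.

(** * Slopes of differentiable functions *)

Section Slopes.
Context {R : realType} {m : nat}.
Implicit Types (f : 'rV[R]_m -> R) (u v w x y : 'rV[R]_m) (c e t : R).

Lemma derive_edot f x v :
  differentiable f x -> 'D_v f x = edot (grad f x) v.
Proof.
move=> df; rewrite deriveE // {1}(row_sum_delta v) linear_sum.
by apply: eq_bigr => i _; rewrite linearZ mxE /= deriveE // mulrC.
Qed.

Lemma slope_gt f x v c : derivable f x v -> c < 'D_v f x ->
  exists2 e, 0 < e & forall t, 0 < t < e -> f x + c * t < f (x + t *: v).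
Proof.
move=> df cD.
have /= [e /= e0 He] := cvgr_gt _ df _ cD; exists e => // t /andP[t0 te].
have /He : ball (0 : R) e t by rewrite /ball /= sub0r normrN gtr0_norm.
rewrite gt_eqF // => /(_ isT).
rewrite /= [_ *: _]mulrC ltr_pdivlMr // [t *: v + x]addrC => H.
by rewrite -ltrBrDl.
Qed.

Lemma derive_le f x v c e : derivable f x v -> 0 < e ->
  (forall t, 0 < t < e -> f (x + t *: v) <= f x + c * t) -> 'D_v f x <= c.
Proof.
move=> df e0 fe; rewrite leNgt; apply/negP => /(slope_gt df)[d d0 fd].
have tP : 0 < Num.min d e / 2 by rewrite divr_gt0 // lt_min d0.
have := fe (Num.min d e / 2); have := fd (Num.min d e / 2).
have [? ?] : Num.min d e <= d /\ Num.min d e <= e by rewrite !ge_min !lexx orbT.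
move=> /(_ ltac:(lra)) H1 /(_ ltac:(lra)) H2; lra.
Qed.

Lemma gradN f x : differentiable f x -> grad (- f) x = - grad f x.
Proof.
move=> df; apply/rowP => i; rewrite !mxE deriveN //.
exact: diff_derivable.
Qed.

Lemma derive_ge f x v c e : differentiable f x -> 0 < e ->
  (forall t, 0 < t < e -> f x + c * t <= f (x + t *: v)) -> c <= 'D_v f x.
Proof.
move=> df e0 fe; rewrite -lerN2 -deriveN; last exact: diff_derivable.
apply: (@derive_le _ _ _ _ e) => //; first exact/diff_derivable/differentiableN.
by move=> t /fe; rewrite !fctE; lra.
Qed.

Lemma is_derive_line f x v t : differentiable f (x + t *: v) ->
  is_derive t 1 (fun s => f (x + s *: v)) (edot (grad f (x + t *: v)) v).
Proof.
move=> df; rewrite -derive_edot //.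
have E : (fun h : R => h^-1 *: (((fun s => f (x + s *: v)) \o shift t) (h *: 1)
            - f (x + t *: v))) =
         (fun h : R => h^-1 *: ((f \o shift (x + t *: v)) (h *: v)
            - f (x + t *: v))).
  apply/funext => h /=; congr (_ *: (f _ - _)).
  by rewrite [h *: 1]mulr1 scalerDl addrCA.
split; first by rewrite /derivable E; exact: diff_derivable.
by rewrite /derive E.
Qed.

(** The mean value theorem on the segment from [x] to [y], whose derivative
    [edot (grad f _) (y - x)] is at most [enorm (y - x)] by Cauchy-Schwarz. *)
Lemma grad_le1_lipschitz f x y :
  (forall t, 0 <= t <= 1 -> differentiable f (x + t *: (y - x))) ->
  (forall t, 0 <= t <= 1 -> enorm (grad f (x + t *: (y - x))) <= 1) ->
  f y - f x <= enorm (y - x).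
Proof.
move=> df gf.
pose g := fun s => f (x + s *: (y - x)).
pose dg := fun s => edot (grad f (x + s *: (y - x))) (y - x).
have gd t : 0 <= t <= 1 -> is_derive t 1 g (dg t).
  by move=> /df; exact: is_derive_line.
have [||c] := @MVT_segment R g dg 0 1 ler01.
- by move=> t; rewrite in_itv /= => /andP[/ltW ? /ltW ?]; apply: gd; apply/andP.
- by apply: derivable_within_continuous => t; rewrite in_itv /= => /gd[].
rewrite /g scale1r scale0r addr0 subrKC subr0 mulr1 => + ->.
rewrite in_itv /= => /gf ge1.
apply: (le_trans (edot_le _ _)); rewrite ler_piMl ?enorm_ge0 //.
Qed.
End Slopes.

(** * The eikonal equation *)

Section Eikonal.
Context {R : realType} {m : nat}.
Implicit Types (f : 'rV[R]_m -> R) (u v x y z : 'rV[R]_m) (c r : R).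

Definition eikonal_on (K : set 'rV[R]_m) f : Prop :=
  forall y, K y -> differentiable f y /\ enorm (grad f y) = 1.

Lemma eikonal_onN K f : eikonal_on K f -> eikonal_on K (- f).
Proof.
move=> fK y /fK[df gf]; split; first exact: differentiableN.
by rewrite gradN // enormN.
Qed.

Lemma eikonal_lipschitz f z r x y :
  eikonal_on [set y | enorm (y - z) <= r] f ->
  enorm (x - z) <= r -> enorm (y - z) <= r -> f y - f x <= enorm (y - x).
Proof.
move=> fK xr yr; apply: grad_le1_lipschitz => t t01.
  by have [] := fK _ (ecball_convex t01 xr yr).
by have [_ ->] := fK _ (ecball_convex t01 xr yr).
Qed.

(** A maximum point of [f y - c * enorm (y - x)] on the ball lies on the
    sphere: from a point inside, a short move along the gradient increases [f]
    faster than the penalty. *)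
Lemma eikonal_slope f x r c : 0 < r -> 0 <= c < 1 ->
  eikonal_on [set y | enorm (y - x) <= r] f ->
  exists2 z, enorm (z - x) <= r & f x + c * r <= f z.
Proof.
move=> r0 /andP[c0 c1] fK; set K := [set y | enorm (y - x) <= r] in fK *.
have Kx : K x by rewrite /K /= subrr enorm0 ltW.
have [||z zK zmax] :=
    @EVT_max_rV R m (fun y => f y - c * enorm (y - x)) K (ex_intro _ x Kx).
- exact: compact_ecball.
- apply: continuous_in_subspaceT => y; rewrite inE => /fK[dfy _].
  apply: (@cvgB _ _ _ (nbhs y) _ f (fun y => c * enorm (y - x))).
    exact: differentiable_continuous.
  by apply: cvgM; [exact: cvg_cst | exact: enorm_dist_continuous].
have {zK} zr : enorm (z - x) <= r by rewrite inE in zK.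
exists z => //.
have [zlt|rz] := ltP (enorm (z - x)) r; last first.
  have := zmax x; rewrite inE subrr enorm0 => /(_ Kx); nra.
have [dfz gz] := fK z zr.
have [||e e0 fe] := @slope_gt R m f z (grad f z) c.
- exact: diff_derivable.
- by rewrite derive_edot // -enorm_sqr gz expr1n.
(* short enough both for the slope estimate and to stay in the ball *)
pose t := Num.min e (r - enorm (z - x)) / 2.
have t0 : 0 < t by rewrite divr_gt0 // lt_min e0 subr_gt0.
have [te tr] : t < e /\ enorm (z - x) + t <= r.
  have [] : Num.min e (r - enorm (z - x)) <= e /\
      Num.min e (r - enorm (z - x)) <= r - enorm (z - x).
    by rewrite !ge_min !lexx orbT.
  by move: t0; rewrite /t; lra.
have Hd : enorm (z + t *: grad f z - x) <= enorm (z - x) + t.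
  rewrite addrAC (le_trans (enormD _ _)) // enormZ gz mulr1 gtr0_norm //.
have ztx := le_trans Hd tr.
have := fe t; rewrite t0 te => /(_ isT).
by have := zmax (z + t *: grad f z); rewrite inE => /(_ ztx); nra.
Qed.

(** A maximum point [y] of [f] on the ball has value at least [f x + r], hence
    lies on the sphere, and the Lipschitz bound between [y] and the points of
    the radius towards [y] makes [f] grow at rate at least 1 on this radius.
    Its direction [e] satisfies [1 <= edot (grad f x) e], so it is the
    gradient. *)
Lemma eikonal_ray f x r : 0 < r ->
  eikonal_on [set y | enorm (y - x) <= r] f ->
  f x + r <= f (x + r *: grad f x).
Proof.
move=> r0 fK.
have Kx : enorm (x - x) <= r by rewrite subrr enorm0 ltW.
have [||y] :=
    @EVT_max_rV R m f [set y | enorm (y - x) <= r] (ex_intro _ x Kx).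
- exact: compact_ecball.
- apply: continuous_in_subspaceT => y; rewrite inE => /fK[dfy _].
  exact: differentiable_continuous.
rewrite inE /= => yr ymax.
have fxy : f x <= f y by apply: ymax; rewrite inE.
have fy : f x + r <= f y.
  rewrite leNgt; apply/negP => fylt.
  (* the midpoint of the slope reached at [y] and of 1 *)
  pose c := (f y - f x + r) / (2 * r).
  have cr : c * r = (f y - f x + r) / 2 by rewrite /c; field; rewrite gt_eqF.
  have [|z zr fz] := @eikonal_slope f x r c r0 _ fK.
    rewrite /c divr_ge0 /=; [|lra..].
    by rewrite ltr_pdivrMr; lra.
  have := ymax z; rewrite inE => /(_ zr); lra.
have yx : enorm (y - x) = r.
  by apply/eqP; rewrite eq_le yr; have := eikonal_lipschitz fK Kx yr; lra.
pose e := r^-1 *: (y - x).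
have rn0 : r != 0 by rewrite gt_eqF.
have e1 : enorm e = 1 by rewrite enormZ yx gtr0_norm ?invr_gt0 // mulVf.
have xe : x + r *: e = y by rewrite scalerA mulfV // scale1r subrKC.
have [dfx gx] := fK x Kx.
have -> : grad f x = e; last by rewrite xe.
apply: unit_edot_eq => //; rewrite -derive_edot //.
apply: (@derive_ge _ _ _ _ _ _ r) => // t /andP[t0 tr].
have te : enorm (x + t *: e - x) <= r.
  by rewrite addrAC subrr add0r enormZ e1 mulr1 gtr0_norm // ltW.
have := eikonal_lipschitz fK te yr.
rewrite -{2}xe opprD addrACA subrr add0r -scalerBl enormZ e1 mulr1.
by rewrite gtr0_norm ?subr_gt0 //; lra.
Qed.

(** [cross] is the Lipschitz bound between the two far ends of rays of
    length [r] issued backwards from [u] and forwards from [v].  Adding the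
    squares of its two instances cancels the mixed products, and [par] is the
    parallelogram law for the unit vectors [grad f x] and [grad f y]. *)
Lemma eikonal_grad_lipschitz f z r x y : 0 < r ->
  eikonal_on [set y | enorm (y - z) <= 2 * r] f ->
  enorm (x - z) <= r -> enorm (y - z) <= r ->
  enorm (grad f x - grad f y) <= r^-1 * enorm (x - y).
Proof.
move=> r0 fK xr yr.
have sub u : enorm (u - z) <= r ->
    [set y | enorm (y - u) <= r] `<=` [set y | enorm (y - z) <= 2 * r].
  by move=> ur v /= vr; have := enorm_distD u v z; lra.
have fwd u (ur : enorm (u - z) <= r) : f u + r <= f (u + r *: grad f u).
  by apply: eikonal_ray => // v /(sub _ ur)/fK.
have bwd u (ur : enorm (u - z) <= r) : f (u - r *: grad f u) <= f u - r.
  have Ku : eikonal_on [set y | enorm (y - u) <= r] (- f).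
    by apply: eikonal_onN => v /(sub _ ur)/fK.
  have := eikonal_ray r0 Ku; rewrite gradN; last first.
    by apply: (proj1 (fK _ _)); rewrite /=; lra.
  by rewrite scalerN !fctE; lra.
have gr1 u (ur : enorm (u - z) <= r) : enorm (grad f u) = 1.
  by apply: (proj2 (fK _ _)); rewrite /=; lra.
have ends u s (ur : enorm (u - z) <= r) : s = 1 \/ s = -1 ->
    enorm (u + (s * r) *: grad f u - z) <= 2 * r.
  move=> s1; rewrite addrAC (le_trans (enormD _ _)) //.
  rewrite enormZ gr1 // mulr1 normrM.
  by case: s1 => ->; rewrite ?normrN1 ?normr1 (gtr0_norm r0); lra.
pose p := grad f x + grad f y; pose q := grad f x - grad f y.
have cross u v (ur : enorm (u - z) <= r) (vr : enorm (v - z) <= r) :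
    f v - f u + 2 * r <= enorm ((v - u) + r *: (grad f u + grad f v)).
  have := eikonal_lipschitz fK (ends u (-1) ur (or_intror erefl))
    (ends v 1 vr (or_introl erefl)).
  rewrite mulN1r mul1r scaleNr.
  have -> : v + r *: grad f v - (u - r *: grad f u) =
      v - u + r *: (grad f u + grad f v).
    by apply/rowP => i; rewrite !mxE; ring.
  by have := fwd v vr; have := bwd u ur; lra.
have par : enorm p ^+ 2 = 4 - enorm q ^+ 2.
  by rewrite !enorm_sqrD enormN !gr1 // [edot _ (- _)]edotC edotNl edotC; ring.
(* [xyf] and [xy2r] make the left-hand sides of [cross] nonnegative *)
have xyf : `|f x - f y| <= enorm (x - y).
  have E u : enorm (u - z) <= r -> enorm (u - z) <= 2 * r by lra.
  rewrite ler_norml (eikonal_lipschitz fK (E _ yr) (E _ xr)) andbT.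
  by have := eikonal_lipschitz fK (E _ xr) (E _ yr); rewrite enormC; lra.
have xy2r : enorm (x - y) <= 2 * r.
  by have := enorm_distD z x y; rewrite (enormC z y); lra.
have c1 := cross y x yr xr; have c2 := cross x y xr yr.
have sqr_le a b : 0 <= a -> a <= b -> a ^+ 2 <= b ^+ 2 :> R by nra.
have {}c1 := sqr_le _ _ _ c1; have {}c2 := sqr_le _ _ _ c2.
move: c1 c2 xyf.
rewrite [grad f y + _]addrC -(opprB x y) -/p !(enorm_sqrD _ (r *: p)).
rewrite enormN enormZ (gtr0_norm r0) edotNl exprMn par ler_norml.
move=> c1 c2 /andP[xyf1 xyf2].
have {}c1 := c1 ltac:(lra); have {}c2 := c2 ltac:(lra).
rewrite -/q ler_pdivlMl // -(ler_pXn2r (n := 2)) ?nnegrE;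
  rewrite ?mulr_ge0 ?enorm_ge0 ?(ltW r0) //.
by rewrite exprMn; have := sqr_ge0 (f x - f y); lra.
Qed.

Lemma eikonal_C11 (W : set 'rV[R]_m) f : open W -> eikonal_on W f -> C11 W f.
Proof.
move=> oW fW; split=> [x /fW[]//|x Wx].
have /nbhs_ballP[e /= e0 eW] := open_nbhs_nbhs (conj oW Wx).
exists [set y | enorm (y - x) <= e / 4].
  have : enorm (y - x) @[y --> x] --> enorm (x - x).
    exact: enorm_dist_continuous.
  by rewrite subrr enorm0 => /cvgr_le; apply; rewrite divr_gt0.
exists (e / 4)^-1 => y z [/= yx _] [/= zx _].
apply: (eikonal_grad_lipschitz _ _ yx zx); first by rewrite divr_gt0.
(* [ball] refers to the sup norm, so it contains the Euclidean ball *)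
move=> u /= ux; apply/fW/eW; rewrite -ball_normE /ball_ /= distrC.
apply: (le_lt_trans (mx_norm_le_enorm _)); lra.
Qed.
End Eikonal.

(** * Distance to the boundary *)

Section BoundaryDistance.
Context {R : realType} {m : nat}.
Implicit Types (f : 'rV[R]_m -> R) (u v x y z : 'rV[R]_m) (D : set 'rV[R]_m).

Lemma near_ray x v (P : set 'rV[R]_m) : nbhs x P ->
  exists2 e : R, 0 < e & forall t, 0 < t < e -> P (x + t *: v).
Proof.
move=> /nbhs_ballP[r /= r0 rP].
have v1 : 0 < enorm v + 1 by rewrite ltr_wpDl ?enorm_ge0.
exists (r / (enorm v + 1)) => [|t /andP[t0]]; first by rewrite divr_gt0.
rewrite ltr_pdivlMr // => tr; apply: rP.
rewrite -ball_normE /ball_ /= opprD addrA subrr sub0r normrN.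
apply: (le_lt_trans (mx_norm_le_enorm _)); rewrite enormZ gtr0_norm //; lra.
Qed.

Lemma boundary_closed (T : topologicalType) (A : set T) : closed (boundary A).
Proof.
rewrite /boundary setDE; apply: closedI; first exact: closed_closure.
exact/open_closedC/open_interior.
Qed.

(** A set with empty boundary is open and closed, and so is its trace on the
    line through a point inside and a point outside, against the connectedness
    of the real line. *)
Lemma boundary_neq0 D : D !=set0 -> D `<` [set: 'rV[R]_m] -> boundary D !=set0.
Proof.
move=> [a Da] [_ /existsNP[b /not_implyP[_ Db]]].
apply/set0P/negP => /eqP B0.
have clD : closure D `<=` D°.
  by move=> x Dx; apply: contrapT => nDx; have : boundary D x by []; rewrite B0.
have oD : open D by rewrite openE => x Dx; exact/clD/subset_closure.
have cD : closed D by move=> x /clD; exact: interior_subset.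
have gc : continuous (fun t : R => a + t *: (b - a)).
  move=> t; apply: (@cvgD _ _ _ (nbhs t) _ (cst a) (fun t => t *: (b - a))).
    exact: cvg_cst.
  by apply: cvgZr_tmp.
pose A := (fun t : R => a + t *: (b - a)) @^-1` D.
have AT : A = setT.
  have cT : connected [set: R] by apply/connected_intervalP.
  apply: cT.
  - by exists 0; rewrite /A /= scale0r addr0.
  - by exists A; [move/continuousP: gc; apply | rewrite setTI].
  - by exists A; [move/continuous_closedP: gc; apply | rewrite setTI].
by have : A 1 by [rewrite AT]; rewrite /A /= scale1r subrKC.
Qed.

Lemma boundary_dist_le D x y : boundary D y -> boundary_dist D x <= enorm (x - y).
Proof.
move=> By; apply: ge_inf; last by exists y.
by exists 0 => _ [z _ <-]; exact: enorm_ge0.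
Qed.

(** Only the part of the boundary inside a ball around [x] through some
    boundary point [b] matters, and this part is compact. *)
Lemma boundary_dist_attained D x : boundary D !=set0 ->
  exists2 y, boundary D y & boundary_dist D x = enorm (x - y).
Proof.
move=> [b Bb].
pose K := boundary D `&` [set y | enorm (y - x) <= enorm (b - x)].
have Kb : K b by split=> /=.
have [||y] := @EVT_min_rV R m (fun y => enorm (y - x)) K (ex_intro _ b Kb).
- rewrite /K setIC; apply: compact_closedI; first exact: compact_ecball.
  exact: boundary_closed.
- by apply: continuous_subspaceT; exact: enorm_dist_continuous.
rewrite inE => -[By yb] ymin; exists y => //.
apply/eqP; rewrite eq_le boundary_dist_le //=.
apply: lb_le_inf; first by exists (enorm (x - b)), b.
move=> _ [z Bz <-]; rewrite enormC [leRHS]enormC.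
have [zb|bz] := leP (enorm (z - x)) (enorm (b - x)).
  by apply: ymin; rewrite inE.
exact: le_trans yb (ltW bz).
Qed.

Lemma boundary_dist_lipschitz D x y : boundary D !=set0 ->
  boundary_dist D y - boundary_dist D x <= enorm (y - x).
Proof.
move=> /(boundary_dist_attained x)[z Bz ->].
by rewrite lerBlDr (le_trans (boundary_dist_le y Bz)) // enorm_distD.
Qed.

(** The gradient has length at most 1 by the Lipschitz bound, and at least 1
    because the distance decreases at rate 1 towards a nearest boundary point.
    It is stated for a function [f] that agrees with the distance only near [x]
    so as to apply to the signed distance, up to sign, on either side of the
    boundary. *)
Lemma enorm_grad_boundary_dist D f x : boundary D !=set0 -> ~ boundary D x ->
  (\forall y \near x, f y = boundary_dist D y) -> differentiable f x ->
  enorm (grad f x) = 1.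
Proof.
move=> B0 nBx fD df.
have fx := nbhs_singleton fD.
have [y By xy] := boundary_dist_attained x B0.
have d0 : 0 < boundary_dist D x.
  rewrite xy lt_def enorm_ge0 andbT; apply/eqP => /enorm_eq0/eqP.
  by rewrite subr_eq0 => /eqP xyE; apply: nBx; rewrite xyE.
apply/eqP; rewrite eq_le; apply/andP; split.
  have [e e0 fe] := near_ray (grad f x) fD.
  have : 'D_(grad f x) f x <= enorm (grad f x).
    apply: (@derive_le _ _ _ _ _ _ e) => // [|t /andP[t0 te]].
      exact: diff_derivable.
    rewrite fe ?t0 // fx.
    have := boundary_dist_lipschitz x (x + t *: grad f x) B0.
    by rewrite addrAC subrr add0r enormZ gtr0_norm //; lra.
  rewrite derive_edot // -enorm_sqr; have := enorm_ge0 (grad f x); nra.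
pose v := (boundary_dist D x)^-1 *: (y - x).
have v1 : enorm v = 1.
  by rewrite enormZ enormC -xy gtr0_norm ?invr_gt0 // mulVf ?gt_eqF.
have xv : y = x + boundary_dist D x *: v.
  by rewrite scalerA mulfV ?gt_eqF // scale1r subrKC.
have [e e0 fe] := near_ray v fD.
have : 'D_v f x <= -1.
  apply: (@derive_le _ _ _ _ _ _ (Num.min e (boundary_dist D x))).
  - exact: diff_derivable.
  - by rewrite lt_min e0.
  move=> t; rewrite lt_min => /and3P[t0 te td]; rewrite fe ?t0 // fx.
  have := boundary_dist_le (x + t *: v) By.
  rewrite xv opprD addrACA subrr add0r -scalerBl enormZ v1 mulr1.
  by rewrite distrC gtr0_norm ?subr_gt0 //; lra.
rewrite derive_edot // => Hv.
have := edot_le (- grad f x) v; rewrite edotNl enormN v1; lra.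
Qed.

Lemma enorm_grad_signed_dist D x :
  open D -> boundary D !=set0 -> ~ boundary D x ->
  differentiable (signed_dist D) x -> enorm (grad (signed_dist D) x) = 1.
Proof.
move=> oD B0 nBx df; have [Dx|nDx] := pselect (D x).
  apply: (enorm_grad_boundary_dist B0 nBx _ df).
  have : nbhs x D by exact: open_nbhs_nbhs.
  by apply: filterS => y Dy; rewrite /signed_dist mem_set.
rewrite -enormN -gradN //.
apply: (enorm_grad_boundary_dist B0 nBx _ (differentiableN df)).
have : nbhs x (~` closure D).
  apply: open_nbhs_nbhs; split; first exact/closed_openC/closed_closure.
  by move=> clx; apply: nBx; split => // /interior_subset.
apply: filterS => y clDy; rewrite !fctE /signed_dist memNset ?opprK //.
by move=> /subset_closure.
Qed.
End BoundaryDistance.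
Theorem proposition4 (R : realType) (m : nat) (hm : (2 <= m)%N) :
  (forall (Omega : set 'rV[R]_m) (phi : 'rV[R]_m -> R),
     open Omega ->
     (forall x, Omega x -> differentiable phi x) ->
     (forall x, Omega x -> enorm (grad phi x) = 1) ->
     C11 Omega phi)
  /\
  (forall (D U : set 'rV[R]_m),
     domain D ->
     D `<` [set: 'rV[R]_m] ->
     open U ->
     boundary D `<=` U ->
     (forall x, U x -> differentiable (signed_dist D) x) ->
     (forall x, (U `&` boundary D) x -> enorm (grad (signed_dist D) x) = 1) ->
     C11 U (signed_dist D)).
Proof.
have eik W f : open W -> (forall x, W x -> differentiable f x) ->
    (forall x, W x -> enorm (grad f x) = 1) -> C11 W f.
  move=> oW df gf; apply: eikonal_C11 => // x Wx.
  by split; [exact: df | exact: gf].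
split=> [|D U [D0 _ oD] DT oU BU df gB]; first exact: eik.
apply: eik => // x Ux; have [Bx|nBx] := pselect (boundary D x); first exact: gB.
by apply: enorm_grad_signed_dist => //; [exact: boundary_neq0 | exact: df].
Qed.
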